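(* If $\Gamma\vdash_{Loc}M:A$ in the polymorphic RPC calculus, then $\mathcal V[\![\Gamma]\!]\vdash_{Loc}\mathcal C[\![M]\!]_{\Gamma,Loc,A}:\mathcal C[\![A]\!]$ in the polymorphic client-server calculus, where $\mathcal C[\![M]\!]_{\Gamma,Loc,A}$ is the slicing compilation of (the given typing derivation of) $M$, the typing is relative to the function maps generated by the compilation, and $\mathcal V[\![\Gamma]\!]$ is the pointwise extension of the type compilation to typing environments.
   Context: Location constants $a,b::=\mathbf c\mid\mathbf s$; $Loc::=a\mid l$ with $l$ a location variable. $\{\cdot/\cdot\}$ is capture-avoiding substitution. **Polymorphic RPC calculus (source).** Types $A,B,C::=base\mid A\xrightarrow{Loc}B\mid\alpha\mid A\times B\mid\forall\alpha.A\mid\forall l.A$. Terms $L,M,N::=V\mid L\,M\mid M[A]\mid M[Loc]\mid(L,M)\mid\pi_i(M)$; values $V,W::=x\mid\lambda^{Loc}x.M\mid\Lambda\alpha.V\mid\Lambda l.V\mid(V,W)$. Environments $\Gamma$: finite lists of $x:A$, $\alpha$, $l$. Typing $\Gamma\vdash_{Loc}M:A$: - $\Gamma\vdash_{Loc}x:A$ if $\Gamma(x)=A$. - $\Gamma,x:A\vdash_{Loc}M:B$ gives $\Gamma\vdash_{Loc'}\lambda^{Loc}x.M:A\xrightarrow{Loc}B$. - $\Gamma\vdash_{Loc}L:A\xrightarrow{Loc'}B$ and $\Gamma\vdash_{Loc}M:A$ give $\Gamma\vdash_{Loc}L\,M:B$. - $\Gamma,\alpha\vdash_{Loc}V:A$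 gives $\Gamma\vdash_{Loc}\Lambda\alpha.V:\forall\alpha.A$; $\Gamma\vdash_{Loc}M:\forall\alpha.A$ gives $\Gamma\vdash_{Loc}M[B]:A\{B/\alpha\}$. - $\Gamma,l\vdash_{Loc}V:A$ gives $\Gamma\vdash_{Loc}\Lambda l.V:\forall l.A$ (bound variable $l$ not occurring in $\Gamma$ or $Loc$); $\Gamma\vdash_{Loc}M:\forall l.A$ gives $\Gamma\vdash_{Loc}M[Loc']:A\{Loc'/l\}$. - $\Gamma\vdash_{Loc}L:A$, $\Gamma\vdash_{Loc}M:B$ give $\Gamma\vdash_{Loc}(L,M):A\times B$; $\Gamma\vdash_{Loc}M:A_1\times A_2$ gives $\Gamma\vdash_{Loc}\pi_i(M):A_i$, $i\in\{1,2\}$. **Polymorphic client-server calculus (target).** Types $A::=base\mid A\xrightarrow{Loc}B\mid Clo(A)\mid A\times B\mid\alpha\mid\forall\alpha.A\mid\forall l.A\mid T\,A$. Values $V,W::=x\mid(V,W)\mid clo(\overline W,F)\mid\Lambda\alpha.V\mid\mathsf{unit}\,V\mid\mathsf{do}\,x\leftarrow M\,\mathsf{in}\,N\mid\mathsf{req}(V,W)\mid\mathsf{call}(V,W)\mid\mathsf{gen}(Loc,V,W)$. Terms $M,N::=V\mid\mathsf{let}\,x=M\,\mathsf{in}\,N\mid\pi_i(V)\mid V(W)\mid V[A]\mid V[Loc]$. Code names $F::=F_{name}[\overline{Loc}\,\overline A]$; code $\overline l\,\overline\alpha.\overline z.OpenCode$ with $OpenCode::=\lambda x.M\mid\Lambda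 l.V$; code types $\overline l\,\overline\alpha.\overline B.A$; a function map is a finite set of bindings $F_{name}:Ty=Code$; a program is a pair $(\Phi_{\mathbf c},\Phi_{\mathbf s})$ of client and server maps. $relocatable(A)$ holds if $A$ is a type variable, $base$, $Clo(B)$ or $\forall\alpha.B$, or $A=A_1\times A_2$ with both $A_i$ relocatable; not otherwise. The bindings of the program are divided into disjoint $\Phi_{\mathbf c}^\circ$ (those only on the client: lambda codes whose function type is annotated $\mathbf c$), $\Phi_{\mathbf s}^\circ$ (likewise for $\mathbf s$), and $\Phi_{common}$ (those on both sides: lambda codes annotated with a location variable, and location abstractions). For typing, $\Phi_{Loc}=\Phi_a^\circ$ if $Loc=a$, and $\Phi_{common}$ if $Loc$ is a variable. Typing $\Gamma\vdash_{Loc}M:A$ (all free variables declared in $\Gamma$): - (Var) $\Gamma(x)=A$ gives $\Gamma\vdash_{Loc}x:A$. (Let) $\Gamma\vdash_{Loc}M:A$, $\Gamma,x:A\vdash_{Loc}N:B$ give $\Gamma\vdash_{Loc}\mathsf{let}\,x=M\,\mathsf{in}\,N:B$. - (Clo) $\vdash F:\overline B.A$ and $\Gamma\vdash_{Loc}W_i:B_i$ for all $i$ give $\Gamma\vdash_{Loc}clo(\overline W,F):Clo(A)$. - (Proj) $\Gamma\vdash_{Loc}V:A_1\times A_2$ gives $\Gamma\vdash_{Loc}\pi_i(V):A_i$. (Pair) $\Gamma\vdash_{Loc}V:A$, $\Gamma\vdash_{Loc}W:B$ give $\Gamma\vdash_{Loc}(V,W):A\times B$. - (Tabs) $\Gamma,\alpha\vdash_{Loc_0}V:A$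 for all $Loc_0$ gives $\Gamma\vdash_{Loc}\Lambda\alpha.V:\forall\alpha.A$. (Tapp) $\Gamma\vdash_{Loc}V:\forall\alpha.A$, $relocatable(B)$ give $\Gamma\vdash_{Loc}V[B]:A\{B/\alpha\}$. (Lapp) $\Gamma\vdash_{Loc}V:Clo(\forall l.A)$ gives $\Gamma\vdash_{Loc}V[Loc']:A\{Loc'/l\}$. - (Unit) $\Gamma\vdash_{Loc}V:A$, $relocatable(A)$ give $\Gamma\vdash_{Loc}\mathsf{unit}\,V:T\,A$. (Bind) $\Gamma\vdash_{Loc}M:T\,A$, $\Gamma,x:A\vdash_{Loc}N:T\,B$ give $\Gamma\vdash_{Loc}\mathsf{do}\,x\leftarrow M\,\mathsf{in}\,N:T\,B$. - (App) $\Gamma\vdash_{Loc}V:Clo(A\xrightarrow{Loc}B)$, $\Gamma\vdash_{Loc}W:A$ give $\Gamma\vdash_{Loc}V(W):B$. - (Gen) $\Gamma\vdash_{Loc}V:Clo(A\xrightarrow{Loc'}T\,B)$, $\Gamma\vdash_{Loc}W:A$, $relocatable(A)$ give $\Gamma\vdash_{Loc}\mathsf{gen}(Loc',V,W):T\,B$. - (Req) the same premises with $Loc=\mathbf c$, $Loc'=\mathbf s$ give $\Gamma\vdash_{\mathbf c}\mathsf{req}(V,W):T\,B$. (Call) with $Loc=\mathbf s$, $Loc'=\mathbf c$ they give $\Gamma\vdash_{\mathbf s}\mathsf{call}(V,W):T\,B$. - (F-Abs) With $\theta=\{\overline{Loc}\,\overline A/\overline l\,\overline\alpha\}$: if $(F_{name}:\overline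 l\,\overline\alpha.\overline B.D\xrightarrow{Loc'}C=\overline l\,\overline\alpha.\overline z.\lambda x.M)\in\Phi_{Loc'}$, $\overline l,\overline\alpha,\overline{z:B},x:D\vdash_{Loc'}M:C$, and all $A_i$, $B_j$ are relocatable, then $\vdash F_{name}[\overline{Loc}\,\overline A]:\overline{B\theta}.(D\xrightarrow{Loc'}C)\theta$. - (F-LAbs) If $(F_{name}:\overline l\,\overline\alpha.\overline B.\forall l.D=\overline l\,\overline\alpha.\overline z.\Lambda l.V)\in\Phi_{common}$, $\overline l,\overline\alpha,\overline{z:B},l\vdash_{Loc_0}V:D$ for all $Loc_0$, and all $A_i$, $B_j$ are relocatable, then $\vdash F_{name}[\overline{Loc}\,\overline A]:\overline{B\theta}.(\forall l.D)\theta$. **Type compilation.** $\mathcal V[\![\alpha]\!]=\alpha$; $\mathcal V[\![base]\!]=base$; $\mathcal V[\![A\xrightarrow{Loc}B]\!]=Clo(\mathcal V[\![A]\!]\xrightarrow{Loc}\mathcal C[\![B]\!])$; $\mathcal V[\![\forall\alpha.A]\!]=\forall\alpha.\mathcal C[\![A]\!]$; $\mathcal V[\![A\times B]\!]=\mathcal V[\![A]\!]\times\mathcal V[\![B]\!]$; $\mathcal V[\![\forall l.A]\!]=Clo(\forall l.\mathcal C[\![A]\!])$; $\mathcal C[\![A]\!]=T\,(\mathcal V[\![A]\!])$. On environments: $\mathcal V[\![\Gamma,x:A]\!]=\mathcal V[\![\Gamma]\!],x:\mathcal V[\![A]\!]$, leaving $\alpha$, $l$ entries unchanged. **Term compilation**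 (on typing derivations; subscripts record environment, location and type). Values: - $\mathcal V[\![x]\!]_{\Gamma,Loc,A}=x$. - $\mathcal V[\![\lambda^{Loc'}x.M]\!]_{\Gamma,Loc,A\xrightarrow{Loc'}B}=clo(\overline z,F_{name}[\overline l\,\overline\alpha])$, where $\Gamma=\{\overline l,\overline\alpha,\overline{z:C}\}$, $F_{name}$ is fresh, and the binding $F_{name}:\overline l\,\overline\alpha.\overline{\mathcal V[\![C]\!]}.\mathcal V[\![A]\!]\xrightarrow{Loc'}\mathcal C[\![B]\!]=\overline l\,\overline\alpha.\overline z.\lambda x.\mathcal C[\![M]\!]_{(\Gamma,x:A),Loc',B}$ is added to the map at $Loc'$ (to both maps if $Loc'$ is a variable). - $\mathcal V[\![\Lambda l.V]\!]_{\Gamma,Loc,\forall l.A}=clo(\overline z,F_{name}[\overline l\,\overline\alpha])$ with $\Gamma$ as before, $F_{name}$ fresh, and $F_{name}:\overline l\,\overline\alpha.\overline{\mathcal V[\![C]\!]}.\forall l.\mathcal C[\![A]\!]=\overline l\,\overline\alpha.\overline z.\Lambda l.\mathcal C[\![V]\!]_{(\Gamma,l),Loc,A}$ added to both maps. - $\mathcal V[\![\Lambda\alpha.V]\!]_{\Gamma,Loc,\forall\alpha.A}=\Lambda\alpha.\mathcal C[\![V]\!]_{(\Gamma,\alpha),Loc,A}$; $\mathcal V[\![(V,W)]\!]_{\Gamma,Loc,A\times B}=(\mathcal V[\![V]\!]_{\Gamma,Loc,A},\mathcal V[\![W]\!]_{\Gamma,Loc,B})$. Terms (the first clause applies to values):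 - $\mathcal C[\![V]\!]_{\Gamma,Loc,A}=\mathsf{unit}\,(\mathcal V[\![V]\!]_{\Gamma,Loc,A})$. - $\mathcal C[\![L\,M]\!]_{\Gamma,Loc,B}=\mathsf{do}\,f\leftarrow\mathcal C[\![L]\!]_{\Gamma,Loc,A\xrightarrow{Loc'}B}\,\mathsf{in}\,\mathsf{do}\,x\leftarrow\mathcal C[\![M]\!]_{\Gamma,Loc,A}\,\mathsf{in}\,R$, where $R=f(x)$ if $Loc=Loc'$; $R=\mathsf{req}(f,x)$ if $Loc=\mathbf c,Loc'=\mathbf s$; $R=\mathsf{call}(f,x)$ if $Loc=\mathbf s,Loc'=\mathbf c$; $R=\mathsf{gen}(Loc',f,x)$ otherwise. - $\mathcal C[\![M[B]]\!]_{\Gamma,Loc,A\{B/\alpha\}}=\mathsf{do}\,f\leftarrow\mathcal C[\![M]\!]_{\Gamma,Loc,\forall\alpha.A}\,\mathsf{in}\,f[\mathcal V[\![B]\!]]$; $\mathcal C[\![M[Loc']]\!]_{\Gamma,Loc,A\{Loc'/l\}}=\mathsf{do}\,f\leftarrow\mathcal C[\![M]\!]_{\Gamma,Loc,\forall l.A}\,\mathsf{in}\,f[Loc']$. - $\mathcal C[\![(L,M)]\!]_{\Gamma,Loc,A\times B}=\mathsf{do}\,x\leftarrow\mathcal C[\![L]\!]_{\Gamma,Loc,A}\,\mathsf{in}\,\mathsf{do}\,y\leftarrow\mathcal C[\![M]\!]_{\Gamma,Loc,B}\,\mathsf{in}\,\mathsf{unit}\,(x,y)$; $\mathcal C[\![\pi_i(M)]\!]_{\Gamma,Loc,A_i}=\mathsf{do}\,p\leftarrow\mathcal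 C[\![M]\!]_{\Gamma,Loc,A_1\times A_2}\,\mathsf{in}\,\mathsf{let}\,x=\pi_i(p)\,\mathsf{in}\,\mathsf{unit}\,x$. Bound variables introduced by the compilation are chosen fresh. *)

(* Defs.v *)
From HB Require Import structures.
From Stdlib Require List.
From mathcomp Require Import all_boot.

Set Implicit Arguments.
Unset Strict Implicit.
Unset Printing Implicit Defensive.

(* Syntax is in de Bruijn form, with three separate index spaces: location
   variables, type variables and term variables.  An index counts only the
   binders of its own sort.  Environments and all binder blocks are listed
   innermost (most recent) first. *)

Inductive site := client | server.

Inductive loc := LSite of site | LVar of nat.

Definition site_eqb (a b : site) : bool :=
  match a, b with client, client | server, server => true | _, _ => false end.

Lemma site_eqP : Equality.axiom site_eqb.
Proof. by case; case; constructor. Qed.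

HB.instance Definition _ := hasDecEq.Build site site_eqP.

Definition loc_eqb (L L' : loc) : bool :=
  match L, L' with
  | LSite a, LSite b => a == b
  | LVar l, LVar l' => l == l'
  | _, _ => false
  end.

Lemma loc_eqP : Equality.axiom loc_eqb.
Proof.
case=> [a|l] [b|l'] /=; try by constructor.
- by apply: (iffP eqP) => [->|[->]].
- by apply: (iffP eqP) => [->|[->]].
Qed.

HB.instance Definition _ := hasDecEq.Build loc loc_eqP.

Definition ren_loc (xi : nat -> nat) (L : loc) : loc :=
  if L is LVar l then LVar (xi l) else L.

Definition subst_loc (sl : nat -> loc) (L : loc) : loc :=
  if L is LVar l then sl l else L.

Definition loc_ok (nl : nat) (L : loc) : bool :=
  if L is LVar l then l < nl else true.

Definition scons (T : Type) (x : T) (s : nat -> T) (n : nat) : T :=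
  if n is n'.+1 then s n' else x.

Definition upren (xi : nat -> nat) : nat -> nat := scons 0 (S \o xi).

Definition up_loc (sl : nat -> loc) : nat -> loc :=
  scons (LVar 0) (ren_loc S \o sl).

Inductive entry (T : Type) := EVar of T | ETy | ELoc.
Arguments ETy {T}.
Arguments ELoc {T}.

Section Env.
Variables (T : Type) (ren : (nat -> nat) -> (nat -> nat) -> T -> T).
Variable ok : nat -> nat -> T -> bool.

Definition nloc (G : seq (entry T)) : nat :=
  count (fun e => if e is ELoc then true else false) G.
Definition nty (G : seq (entry T)) : nat :=
  count (fun e => if e is ETy then true else false) G.
Definition nvar (G : seq (entry T)) : nat :=
  count (fun e => if e is EVar _ then true else false) G.

(* The types of the term variables of G.  A stored type refers to the entries
   below it in G; here it is shifted so as to refer to the whole of G. *)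
Fixpoint vars (G : seq (entry T)) : seq T :=
  match G with
  | [::] => [::]
  | EVar A :: G' => A :: vars G'
  | ETy :: G' => map (ren id S) (vars G')
  | ELoc :: G' => map (ren S id) (vars G')
  end.

Fixpoint env_ok (G : seq (entry T)) : bool :=
  match G with
  | [::] => true
  | EVar A :: G' => ok (nloc G') (nty G') A && env_ok G'
  | _ :: G' => env_ok G'
  end.

End Env.

Inductive ty :=
| Base
| Fun of ty & loc & ty
| TyVar of nat
| Prod of ty & ty
| AllT of ty
| AllL of ty.

(* First argument: location variables; second argument: type variables. *)
Fixpoint ren_ty (xl xt : nat -> nat) (A : ty) : ty :=
  match A with
  | Base => Base
  | Fun A1 L A2 => Fun (ren_ty xl xt A1) (ren_loc xl L) (ren_ty xl xt A2)
  | TyVar a => TyVar (xt a)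
  | Prod A1 A2 => Prod (ren_ty xl xt A1) (ren_ty xl xt A2)
  | AllT A1 => AllT (ren_ty xl (upren xt) A1)
  | AllL A1 => AllL (ren_ty (upren xl) xt A1)
  end.

Fixpoint subst_ty (sl : nat -> loc) (st : nat -> ty) (A : ty) : ty :=
  match A with
  | Base => Base
  | Fun A1 L A2 => Fun (subst_ty sl st A1) (subst_loc sl L) (subst_ty sl st A2)
  | TyVar a => st a
  | Prod A1 A2 => Prod (subst_ty sl st A1) (subst_ty sl st A2)
  | AllT A1 => AllT (subst_ty sl (scons (TyVar 0) (ren_ty id S \o st)) A1)
  | AllL A1 => AllL (subst_ty (up_loc sl) (ren_ty S id \o st) A1)
  end.

Definition inst_ty (A B : ty) : ty := subst_ty LVar (scons B TyVar) A.
Definition inst_loc (A : ty) (L : loc) : ty := subst_ty (scons L LVar) TyVar A.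

Fixpoint ty_ok (nl nt : nat) (A : ty) : bool :=
  match A with
  | Base => true
  | Fun A1 L A2 => [&& ty_ok nl nt A1, loc_ok nl L & ty_ok nl nt A2]
  | TyVar a => a < nt
  | Prod A1 A2 => ty_ok nl nt A1 && ty_ok nl nt A2
  | AllT A1 => ty_ok nl nt.+1 A1
  | AllL A1 => ty_ok nl.+1 nt A1
  end.

Inductive proj := pfst | psnd.

Definition pick_proj (T : Type) (i : proj) (x y : T) : T :=
  if i is pfst then x else y.

(* Values are a subset of the terms, see [is_value].  That the bodies of TLam
   and LLam are values is imposed by the typing rules. *)
Inductive term :=
| Var of nat
| Lam of loc & term
| App of term & term
| TLam of term
| TApp of term & ty
| LLam of term
| LApp of term & loc
| Pair of term & term
| Proj of proj & term.

Fixpoint is_value (M : term) : bool :=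
  match M with
  | Var _ | Lam _ _ => true
  | TLam V | LLam V => is_value V
  | Pair V W => is_value V && is_value W
  | _ => false
  end.

Fixpoint term_ok (nl nt k : nat) (M : term) : bool :=
  match M with
  | Var x => x < k
  | Lam L N => loc_ok nl L && term_ok nl nt k.+1 N
  | App N1 N2 => term_ok nl nt k N1 && term_ok nl nt k N2
  | TLam V => term_ok nl nt.+1 k V
  | TApp N A => term_ok nl nt k N && ty_ok nl nt A
  | LLam V => term_ok nl.+1 nt k V
  | LApp N L => term_ok nl nt k N && loc_ok nl L
  | Pair N1 N2 => term_ok nl nt k N1 && term_ok nl nt k N2
  | Proj _ N => term_ok nl nt k N
  end.

Definition env := seq (entry ty).

(* All free variables of the judgement are declared in G. *)
Definition scoped (G : env) (L : loc) (M : term) (A : ty) : bool :=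
  [&& env_ok ty_ok G, loc_ok (nloc G) L,
      term_ok (nloc G) (nty G) (nvar G) M & ty_ok (nloc G) (nty G) A].

(* In Type, because compilation proceeds by recursion on derivations. *)
Inductive typing : env -> loc -> term -> ty -> Type :=
| T_Var G L x A :
    scoped G L (Var x) A ->
    onth (vars ren_ty G) x = Some A ->
    typing G L (Var x) A
| T_Lam G L L' M A B :
    scoped G L (Lam L' M) (Fun A L' B) ->
    typing (EVar A :: G) L' M B ->
    typing G L (Lam L' M) (Fun A L' B)
| T_App G L L' M N A B :
    scoped G L (App M N) B ->
    typing G L M (Fun A L' B) ->
    typing G L N A ->
    typing G L (App M N) B
| T_TLam G L V A :
    scoped G L (TLam V) (AllT A) ->
    is_value V ->
    typing (ETy :: G) L V A ->
    typing G L (TLam V) (AllT A)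
| T_TApp G L M A B :
    scoped G L (TApp M B) (inst_ty A B) ->
    typing G L M (AllT A) ->
    typing G L (TApp M B) (inst_ty A B)
| T_LLam G L V A :
    scoped G L (LLam V) (AllL A) ->
    is_value V ->
    typing (ELoc :: G) (ren_loc S L) V A ->
    typing G L (LLam V) (AllL A)
| T_LApp G L L' M A :
    scoped G L (LApp M L') (inst_loc A L') ->
    typing G L M (AllL A) ->
    typing G L (LApp M L') (inst_loc A L')
| T_Pair G L M N A B :
    scoped G L (Pair M N) (Prod A B) ->
    typing G L M A ->
    typing G L N B ->
    typing G L (Pair M N) (Prod A B)
| T_Proj G L i M A1 A2 :
    scoped G L (Proj i M) (pick_proj i A1 A2) ->
    typing G L M (Prod A1 A2) ->
    typing G L (Proj i M) (pick_proj i A1 A2).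

Inductive cty :=
| CBase
| CFun of cty & loc & cty
| CClo of cty
| CProd of cty & cty
| CTyVar of nat
| CAllT of cty
| CAllL of cty
| CMon of cty.

Fixpoint ren_cty (xl xt : nat -> nat) (A : cty) : cty :=
  match A with
  | CBase => CBase
  | CFun A1 L A2 => CFun (ren_cty xl xt A1) (ren_loc xl L) (ren_cty xl xt A2)
  | CClo A1 => CClo (ren_cty xl xt A1)
  | CProd A1 A2 => CProd (ren_cty xl xt A1) (ren_cty xl xt A2)
  | CTyVar a => CTyVar (xt a)
  | CAllT A1 => CAllT (ren_cty xl (upren xt) A1)
  | CAllL A1 => CAllL (ren_cty (upren xl) xt A1)
  | CMon A1 => CMon (ren_cty xl xt A1)
  end.

Fixpoint subst_cty (sl : nat -> loc) (st : nat -> cty) (A : cty) : cty :=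
  match A with
  | CBase => CBase
  | CFun A1 L A2 =>
      CFun (subst_cty sl st A1) (subst_loc sl L) (subst_cty sl st A2)
  | CClo A1 => CClo (subst_cty sl st A1)
  | CProd A1 A2 => CProd (subst_cty sl st A1) (subst_cty sl st A2)
  | CTyVar a => st a
  | CAllT A1 => CAllT (subst_cty sl (scons (CTyVar 0) (ren_cty id S \o st)) A1)
  | CAllL A1 => CAllL (subst_cty (up_loc sl) (ren_cty S id \o st) A1)
  | CMon A1 => CMon (subst_cty sl st A1)
  end.

Definition cinst_ty (A B : cty) : cty := subst_cty LVar (scons B CTyVar) A.
Definition cinst_loc (A : cty) (L : loc) : cty :=
  subst_cty (scons L LVar) CTyVar A.

(* Simultaneous substitution of Ls and As for the binder block of a code type,
   which has no other free variables. *)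
Definition theta (Ls : seq loc) (As : seq cty) : cty -> cty :=
  subst_cty (fun l => nth (LVar l) Ls l) (fun a => nth (CTyVar a) As a).

Fixpoint cty_ok (nl nt : nat) (A : cty) : bool :=
  match A with
  | CBase => true
  | CFun A1 L A2 => [&& cty_ok nl nt A1, loc_ok nl L & cty_ok nl nt A2]
  | CClo A1 | CMon A1 => cty_ok nl nt A1
  | CProd A1 A2 => cty_ok nl nt A1 && cty_ok nl nt A2
  | CTyVar a => a < nt
  | CAllT A1 => cty_ok nl nt.+1 A1
  | CAllL A1 => cty_ok nl.+1 nt A1
  end.

Fixpoint relocatable (A : cty) : bool :=
  match A with
  | CTyVar _ | CBase | CClo _ | CAllT _ => true
  | CProd A1 A2 => relocatable A1 && relocatable A2
  | _ => false
  end.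

Definition fname := nat.

Record cname := CName {
  cn_name : fname;
  cn_locs : seq loc;
  cn_tys : seq cty }.

Inductive cval :=
| VVar of nat
| VPair of cval & cval
| VClo of seq cval & cname
| VTLam of cval
| VUnit of cval
| VDo of cterm & cterm                (* binds a variable in the second term *)
| VReq of cval & cval
| VCall of cval & cval
| VGen of loc & cval & cval
with cterm :=
| Val of cval
| Let of cterm & cterm                (* binds a variable in the second term *)
| CProj of proj & cval
| CApp of cval & cval
| CTApp of cval & cty
| CLApp of cval & loc.

Inductive opencode := OLam of cterm | OLLam of cval.

(* The binder block of a code: numbers of location, type and term variables. *)
Record code := Code {
  code_nl : nat;
  code_nt : nat;
  code_nz : nat;
  code_body : opencode }.

(* The types of the free variables z and the type of the open code, under
   the given numbers of location and type variables. *)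
Record codety := CodeTy {
  ct_nl : nat;
  ct_nt : nat;
  ct_env : seq cty;
  ct_ty : cty }.

Record binding := Binding {
  b_name : fname;
  b_ty : codety;
  b_code : code }.

Definition funmap := seq binding.

Definition program := (funmap * funmap)%type. (* client map, server map *)

(* The part of the program against which code annotated with a given location
   is typed: bindings only on the client, only on the server, or on both. *)
Definition phi (P : program) (L : loc) (b : binding) : Prop :=
  match L with
  | LSite client => List.In b P.1 /\ ~ List.In b P.2
  | LSite server => List.In b P.2 /\ ~ List.In b P.1
  | LVar _ => List.In b P.1 /\ List.In b P.2
  end.

Definition phi_common (P : program) (b : binding) : Prop :=
  List.In b P.1 /\ List.In b P.2.

Definition cname_ok (nl nt : nat) (F : cname) : bool :=
  all (loc_ok nl) (cn_locs F) && all (cty_ok nl nt) (cn_tys F).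

Fixpoint cval_ok (nl nt k : nat) (V : cval) : bool :=
  match V with
  | VVar x => x < k
  | VPair V1 V2 | VReq V1 V2 | VCall V1 V2 =>
      cval_ok nl nt k V1 && cval_ok nl nt k V2
  | VClo Ws F => all (cval_ok nl nt k) Ws && cname_ok nl nt F
  | VTLam V1 => cval_ok nl nt.+1 k V1
  | VUnit V1 => cval_ok nl nt k V1
  | VDo M N => cterm_ok nl nt k M && cterm_ok nl nt k.+1 N
  | VGen L V1 V2 => [&& loc_ok nl L, cval_ok nl nt k V1 & cval_ok nl nt k V2]
  end
with cterm_ok (nl nt k : nat) (M : cterm) : bool :=
  match M with
  | Val V => cval_ok nl nt k V
  | Let M1 N => cterm_ok nl nt k M1 && cterm_ok nl nt k.+1 N
  | CProj _ V => cval_ok nl nt k V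
  | CApp V W => cval_ok nl nt k V && cval_ok nl nt k W
  | CTApp V A => cval_ok nl nt k V && cty_ok nl nt A
  | CLApp V L => cval_ok nl nt k V && loc_ok nl L
  end.

Definition cenv := seq (entry cty).

(* All free variables of the judgement are declared in G. *)
Definition cscoped (G : cenv) (L : loc) (M : cterm) (A : cty) : bool :=
  [&& env_ok cty_ok G, loc_ok (nloc G) L,
      cterm_ok (nloc G) (nty G) (nvar G) M & cty_ok (nloc G) (nty G) A].

Definition code_env (nl nt : nat) (Bs : seq cty) : cenv :=
  map (@EVar cty) Bs ++ nseq nt ETy ++ nseq nl ELoc.

Inductive ctyping (P : program) : cenv -> loc -> cterm -> cty -> Prop :=
| C_Var G L x A :
    cscoped G L (Val (VVar x)) A ->
    onth (vars ren_cty G) x = Some A ->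
    ctyping P G L (Val (VVar x)) A
| C_Let G L M N A B :
    cscoped G L (Let M N) B ->
    ctyping P G L M A ->
    ctyping P (EVar A :: G) L N B ->
    ctyping P G L (Let M N) B
| C_Clo G L Ws F Bs A :
    cscoped G L (Val (VClo Ws F)) (CClo A) ->
    cntyping P F Bs A ->
    size Ws = size Bs ->
    (forall i, i < size Bs ->
       ctyping P G L (Val (nth (VVar 0) Ws i)) (nth CBase Bs i)) ->
    ctyping P G L (Val (VClo Ws F)) (CClo A)
| C_Proj G L i V A1 A2 :
    cscoped G L (CProj i V) (pick_proj i A1 A2) ->
    ctyping P G L (Val V) (CProd A1 A2) ->
    ctyping P G L (CProj i V) (pick_proj i A1 A2)
| C_Pair G L V W A B :
    cscoped G L (Val (VPair V W)) (CProd A B) ->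
    ctyping P G L (Val V) A ->
    ctyping P G L (Val W) B ->
    ctyping P G L (Val (VPair V W)) (CProd A B)
| C_TLam G L V A :
    cscoped G L (Val (VTLam V)) (CAllT A) ->
    (forall L0, loc_ok (nloc G) L0 -> ctyping P (ETy :: G) L0 (Val V) A) ->
    ctyping P G L (Val (VTLam V)) (CAllT A)
| C_TApp G L V A B :
    cscoped G L (CTApp V B) (cinst_ty A B) ->
    ctyping P G L (Val V) (CAllT A) ->
    relocatable B ->
    ctyping P G L (CTApp V B) (cinst_ty A B)
| C_LApp G L L' V A :
    cscoped G L (CLApp V L') (cinst_loc A L') ->
    ctyping P G L (Val V) (CClo (CAllL A)) ->
    ctyping P G L (CLApp V L') (cinst_loc A L')
| C_Unit G L V A :
    cscoped G L (Val (VUnit V)) (CMon A) ->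
    ctyping P G L (Val V) A ->
    relocatable A ->
    ctyping P G L (Val (VUnit V)) (CMon A)
| C_Bind G L M N A B :
    cscoped G L (Val (VDo M N)) (CMon B) ->
    ctyping P G L M (CMon A) ->
    ctyping P (EVar A :: G) L N (CMon B) ->
    ctyping P G L (Val (VDo M N)) (CMon B)
| C_App G L V W A B :
    cscoped G L (CApp V W) B ->
    ctyping P G L (Val V) (CClo (CFun A L B)) ->
    ctyping P G L (Val W) A ->
    ctyping P G L (CApp V W) B
| C_Gen G L L' V W A B :
    cscoped G L (Val (VGen L' V W)) (CMon B) ->
    ctyping P G L (Val V) (CClo (CFun A L' (CMon B))) ->
    ctyping P G L (Val W) A ->
    relocatable A ->
    ctyping P G L (Val (VGen L' V W)) (CMon B)
| C_Req G V W A B :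
    cscoped G (LSite client) (Val (VReq V W)) (CMon B) ->
    ctyping P G (LSite client) (Val V)
      (CClo (CFun A (LSite server) (CMon B))) ->
    ctyping P G (LSite client) (Val W) A ->
    relocatable A ->
    ctyping P G (LSite client) (Val (VReq V W)) (CMon B)
| C_Call G V W A B :
    cscoped G (LSite server) (Val (VCall V W)) (CMon B) ->
    ctyping P G (LSite server) (Val V)
      (CClo (CFun A (LSite client) (CMon B))) ->
    ctyping P G (LSite server) (Val W) A ->
    relocatable A ->
    ctyping P G (LSite server) (Val (VCall V W)) (CMon B)
with cntyping (P : program) : cname -> seq cty -> cty -> Prop :=
| F_Abs F nl nt Bs D L' C M Ls As :
    size Ls = nl -> size As = nt ->
    phi P L' (Binding F (CodeTy nl nt Bs (CFun D L' C))
                        (Code nl nt (size Bs) (OLam M))) ->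
    ctyping P (EVar D :: code_env nl nt Bs) L' M C ->
    all relocatable As -> all relocatable Bs ->
    cntyping P (CName F Ls As)
      (map (theta Ls As) Bs) (theta Ls As (CFun D L' C))
| F_LAbs F nl nt Bs D V Ls As :
    size Ls = nl -> size As = nt ->
    phi_common P (Binding F (CodeTy nl nt Bs (CAllL D))
                            (Code nl nt (size Bs) (OLLam V))) ->
    (forall L0, loc_ok nl.+1 L0 ->
       ctyping P (ELoc :: code_env nl nt Bs) L0 (Val V) D) ->
    all relocatable As -> all relocatable Bs ->
    cntyping P (CName F Ls As)
      (map (theta Ls As) Bs) (theta Ls As (CAllL D)).

(* Renaming of term variables, used to bring a term under a new term binder. *)
Fixpoint ren_cval (xi : nat -> nat) (V : cval) : cval :=
  match V with
  | VVar x => VVar (xi x)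
  | VPair V1 V2 => VPair (ren_cval xi V1) (ren_cval xi V2)
  | VClo Ws F => VClo (map (ren_cval xi) Ws) F
  | VTLam V1 => VTLam (ren_cval xi V1)
  | VUnit V1 => VUnit (ren_cval xi V1)
  | VDo M N => VDo (ren_cterm xi M) (ren_cterm (upren xi) N)
  | VReq V1 V2 => VReq (ren_cval xi V1) (ren_cval xi V2)
  | VCall V1 V2 => VCall (ren_cval xi V1) (ren_cval xi V2)
  | VGen L V1 V2 => VGen L (ren_cval xi V1) (ren_cval xi V2)
  end
with ren_cterm (xi : nat -> nat) (M : cterm) : cterm :=
  match M with
  | Val V => Val (ren_cval xi V)
  | Let M1 N => Let (ren_cterm xi M1) (ren_cterm (upren xi) N)
  | CProj i V => CProj i (ren_cval xi V)
  | CApp V W => CApp (ren_cval xi V) (ren_cval xi W)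
  | CTApp V A => CTApp (ren_cval xi V) A
  | CLApp V L => CLApp (ren_cval xi V) L
  end.

Fixpoint compV_ty (A : ty) : cty :=
  match A with
  | Base => CBase
  | Fun A1 L A2 => CClo (CFun (compV_ty A1) L (CMon (compV_ty A2)))
  | TyVar a => CTyVar a
  | Prod A1 A2 => CProd (compV_ty A1) (compV_ty A2)
  | AllT A1 => CAllT (CMon (compV_ty A1))
  | AllL A1 => CClo (CAllL (CMon (compV_ty A1)))
  end.

Definition compC_ty (A : ty) : cty := CMon (compV_ty A).

Definition comp_entry (e : entry ty) : entry cty :=
  match e with EVar A => EVar (compV_ty A) | ETy => ETy | ELoc => ELoc end.

Definition comp_env (G : env) : cenv := map comp_entry G.

(* R, in the scope of the binders f (index 1) and x (index 0). *)
Definition comp_call (L L' : loc) : cterm :=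
  if L == L' then CApp (VVar 1) (VVar 0) else
  match L, L' with
  | LSite client, LSite server => Val (VReq (VVar 1) (VVar 0))
  | LSite server, LSite client => Val (VCall (VVar 1) (VVar 0))
  | _, _ => Val (VGen L' (VVar 1) (VVar 0))
  end.

(* clo(z, F[l a]) where l, a, z are all the variables of G. *)
Definition closure (G : env) (F : fname) : cval :=
  VClo (map VVar (iota 0 (nvar G)))
       (CName F (map LVar (iota 0 (nloc G))) (map CTyVar (iota 0 (nty G)))).

(* G = {l, a, z : C}: the binders are regrouped by sort, which leaves the
   indices unchanged. *)
Definition comp_codety (G : env) (A : cty) : codety :=
  CodeTy (nloc G) (nty G) (map compV_ty (vars ren_ty G)) A.
Definition comp_code (G : env) (o : opencode) : code :=
  Code (nloc G) (nty G) (nvar G) o.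

Definition add_both (b : binding) (P : program) : program :=
  (b :: P.1, b :: P.2).
Definition add_at (L : loc) (b : binding) (P : program) : program :=
  match L with
  | LSite client => (b :: P.1, P.2)
  | LSite server => (P.1, b :: P.2)
  | LVar _ => add_both b P
  end.

Definition used (P : program) : seq fname := map b_name P.1 ++ map b_name P.2.

(* AsVal computes V[[M]] and AsTerm computes C[[M]]; they share one recursion
   because C[[V]] = unit V[[V]] uses the derivation of V itself. *)
Inductive mode := AsVal | AsTerm.

Definition inject (m : mode) (V : cval) : cval :=
  if m is AsTerm then VUnit V else V.

(* [fresh] chooses a function name outside a given list of names.  The program
   generated so far is threaded through the compilation.  In mode AsVal only
   derivations for values are meaningful.  Compiled terms are always target
   values (unit or do). *)
Fixpoint slice (fresh : seq fname -> fname) (m : mode)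
    (G : env) (L : loc) (M : term) (A : ty) (d : typing G L M A)
    (P : program) {struct d} : cval * program :=
  match d with
  | T_Var _ _ x _ _ _ => (inject m (VVar x), P)
  | T_Lam G _ L' _ A B _ d1 =>
      let: (N, P1) := slice fresh AsTerm d1 P in
      let F := fresh (used P1) in
      let b := Binding F (comp_codety G (CFun (compV_ty A) L' (compC_ty B)))
                         (comp_code G (OLam (Val N))) in
      (inject m (closure G F), add_at L' b P1)
  | T_LLam G _ _ A _ _ d1 =>
      let: (V, P1) := slice fresh AsTerm d1 P in
      let F := fresh (used P1) in
      let b := Binding F (comp_codety G (CAllL (compC_ty A)))
                         (comp_code G (OLLam V)) in
      (inject m (closure G F), add_both b P1)
  | T_TLam _ _ _ _ _ _ d1 =>
      let: (V, P1) := slice fresh AsTerm d1 P in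
      (inject m (VTLam V), P1)
  | T_App _ L L' _ _ _ _ _ d1 d2 =>
      let: (N1, P1) := slice fresh AsTerm d1 P in
      let: (N2, P2) := slice fresh AsTerm d2 P1 in
      (VDo (Val N1) (Val (VDo (ren_cterm S (Val N2)) (comp_call L L'))), P2)
  | T_TApp _ _ _ _ B _ d1 =>
      let: (N1, P1) := slice fresh AsTerm d1 P in
      (VDo (Val N1) (CTApp (VVar 0) (compV_ty B)), P1)
  | T_LApp _ _ L' _ _ _ d1 =>
      let: (N1, P1) := slice fresh AsTerm d1 P in
      (VDo (Val N1) (CLApp (VVar 0) L'), P1)
  | T_Pair _ _ M N _ _ _ d1 d2 =>
      if is_value M && is_value N then
        let: (V1, P1) := slice fresh AsVal d1 P in
        let: (V2, P2) := slice fresh AsVal d2 P1 in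
        (inject m (VPair V1 V2), P2)
      else
        let: (N1, P1) := slice fresh AsTerm d1 P in
        let: (N2, P2) := slice fresh AsTerm d2 P1 in
        (VDo (Val N1) (Val (VDo (ren_cterm S (Val N2))
                                (Val (VUnit (VPair (VVar 1) (VVar 0)))))), P2)
  | T_Proj _ _ i _ _ _ _ d1 =>
      let: (N1, P1) := slice fresh AsTerm d1 P in
      (VDo (Val N1) (Let (CProj i (VVar 0)) (Val (VUnit (VVar 0)))), P1)
  end.

Definition compC (fresh : seq fname -> fname)
    (G : env) (L : loc) (M : term) (A : ty) (d : typing G L M A) : cterm :=
  Val (slice fresh AsTerm d ([::], [::])).1.

Definition comp_program (fresh : seq fname -> fname)
    (G : env) (L : loc) (M : term) (A : ty) (d : typing G L M A) : program :=
  (slice fresh AsTerm d ([::], [::])).2.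

(* Main.v *)
(* A value compiles to code that is typable at every location, although its
   derivation fixes one: this is what the location-polymorphic premises of
   (Tabs) and (F-LAbs) require.  A closure is instantiated with the
   variables of its own environment, so the substitution theta of its code
   type is the identity, and what remains is that target typing only depends
   on the numbers of location and type variables and on the list of types of
   the term variables, not on how the entries are interleaved.  Freshness of
   the function names ensures that a binding found on one side only stays so
   while the program grows. *)
Require Import Defs.
From Stdlib Require List.
From mathcomp Require Import all_boot.

Set Implicit Arguments.
Unset Strict Implicit.
Unset Printing Implicit Defensive.

(* Induction principles for target typing and target syntax *)
Scheme ctyping_mind := Minimality for ctyping Sort Prop
  with cntyping_mind := Minimality for cntyping Sort Prop.

(** The values listed inside [VClo] need induction hypotheses of their own, which an inner fixpoint
    collects in a [List.Forall]. *)
Section CvalInd.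
Variables (PV : cval -> Prop) (PM : cterm -> Prop).
Hypothesis HVar : forall x, PV (VVar x).
Hypothesis HPair : forall V W, PV V -> PV W -> PV (VPair V W).
Hypothesis HClo : forall Ws F, List.Forall PV Ws -> PV (VClo Ws F).
Hypothesis HTLam : forall V, PV V -> PV (VTLam V).
Hypothesis HUnit : forall V, PV V -> PV (VUnit V).
Hypothesis HDo : forall M N, PM M -> PM N -> PV (VDo M N).
Hypothesis HReq : forall V W, PV V -> PV W -> PV (VReq V W).
Hypothesis HCall : forall V W, PV V -> PV W -> PV (VCall V W).
Hypothesis HGen : forall L V W, PV V -> PV W -> PV (VGen L V W).
Hypothesis HVal : forall V, PV V -> PM (Val V).
Hypothesis HLet : forall M N, PM M -> PM N -> PM (Let M N).
Hypothesis HProj : forall i V, PV V -> PM (CProj i V).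
Hypothesis HApp : forall V W, PV V -> PV W -> PM (CApp V W).
Hypothesis HTApp : forall V A, PV V -> PM (CTApp V A).
Hypothesis HLApp : forall V L, PV V -> PM (CLApp V L).

Fixpoint cval_nested_ind (V : cval) : PV V :=
  match V with
  | VVar x => HVar x
  | VPair V W => HPair (cval_nested_ind V) (cval_nested_ind W)
  | VClo Ws F => HClo F
      ((fix all_ind Ws : List.Forall PV Ws :=
          match Ws with
          | [::] => List.Forall_nil PV
          | W :: Ws' => List.Forall_cons W (cval_nested_ind W) (all_ind Ws')
          end) Ws)
  | VTLam V => HTLam (cval_nested_ind V)
  | VUnit V => HUnit (cval_nested_ind V)
  | VDo M N => HDo (cterm_nested_ind M) (cterm_nested_ind N)
  | VReq V W => HReq (cval_nested_ind V) (cval_nested_ind W)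
  | VCall V W => HCall (cval_nested_ind V) (cval_nested_ind W)
  | VGen L V W => HGen L (cval_nested_ind V) (cval_nested_ind W)
  end
with cterm_nested_ind (M : cterm) : PM M :=
  match M with
  | Val V => HVal (cval_nested_ind V)
  | Let M N => HLet (cterm_nested_ind M) (cterm_nested_ind N)
  | CProj i V => HProj i (cval_nested_ind V)
  | CApp V W => HApp (cval_nested_ind V) (cval_nested_ind W)
  | CTApp V A => HTApp A (cval_nested_ind V)
  | CLApp V L => HLApp L (cval_nested_ind V)
  end.

Lemma cval_cterm_ind : (forall V, PV V) /\ (forall M, PM M).
Proof. by split; [exact: cval_nested_ind | exact: cterm_nested_ind]. Qed.
End CvalInd.

(** * Renaming: identity and preservation of scoping *)

Lemma upren_id (xi : nat -> nat) : xi =1 id -> upren xi =1 id.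
Proof. by move=> e [|x] //=; rewrite e. Qed.

Lemma upren_lt (xi : nat -> nat) (k k' : nat) :
  (forall x, x < k -> xi x < k') -> forall x, x < k.+1 -> upren xi x < k'.+1.
Proof. by move=> h [|x] //=; rewrite !ltnS; apply: h. Qed.

(** The hypothesis is pointwise because going under a binder turns [id] into [upren id], which
    equals [id] only pointwise. *)
Lemma ren_id_cval_cterm :
  (forall V xi, xi =1 id -> ren_cval xi V = V) /\
  (forall M xi, xi =1 id -> ren_cterm xi M = M).
Proof.
apply: cval_cterm_ind => /=; try by [move=> *; f_equal; eauto using upren_id].
move=> Ws F IH xi e; congr VClo.
by elim: IH => //= W Ws' IHW _ ->; rewrite IHW.
Qed.

Lemma ren_cterm_id (M : cterm) : ren_cterm id M = M.
Proof. by apply: ren_id_cval_cterm.2. Qed.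

Lemma ren_ok_cval_cterm :
  (forall V nl nt k k' xi, (forall x, x < k -> xi x < k') ->
     cval_ok nl nt k V -> cval_ok nl nt k' (ren_cval xi V)) /\
  (forall M nl nt k k' xi, (forall x, x < k -> xi x < k') ->
     cterm_ok nl nt k M -> cterm_ok nl nt k' (ren_cterm xi M)).
Proof.
apply: cval_cterm_ind => /=.
all: try by intros; repeat match goal with H : is_true (_ && _) |- _ =>
         case/andP: H => ? ? end;
       repeat (apply/andP; split); eauto using upren_lt.
move=> Ws F IH nl nt k k' xi h /andP[ws ->]; rewrite andbT.
by elim: IH ws => //= W Ws' IHW _ IH /andP[w /IH ->]; rewrite (IHW _ _ k).
Qed.

Lemma cterm_ok_ren nl nt k k' xi M :
  (forall x, x < k -> xi x < k') ->
  cterm_ok nl nt k M -> cterm_ok nl nt k' (ren_cterm xi M).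
Proof. exact: ren_ok_cval_cterm.2. Qed.

Lemma loc_ok_ren nl nl' xl L :
  (forall x, x < nl -> xl x < nl') -> loc_ok nl L -> loc_ok nl' (ren_loc xl L).
Proof. by case: L => //= l; apply. Qed.

Lemma cty_ok_ren A nl nt nl' nt' xl xt :
  (forall x, x < nl -> xl x < nl') -> (forall x, x < nt -> xt x < nt') ->
  cty_ok nl nt A -> cty_ok nl' nt' (ren_cty xl xt A).
Proof.
elim: A nl nt nl' nt' xl xt => //=.
- move=> A IHA L B IHB nl nt nl' nt' xl xt hl ht /and3P[a l b].
  by rewrite (IHA nl nt) // (IHB nl nt) // (loc_ok_ren hl).
- move=> A IHA B IHB nl nt nl' nt' xl xt hl ht /andP[a b].
  by rewrite (IHA nl nt) // (IHB nl nt).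
- by move=> a nl nt nl' nt' xl xt hl ht; apply: ht.
- move=> A IHA nl nt nl' nt' xl xt hl ht; apply: IHA; first [done | exact: upren_lt].
- move=> A IHA nl nt nl' nt' xl xt hl ht; apply: IHA; first [done | exact: upren_lt].
Qed.

(** * Identity substitutions on target types *)

Lemma subst_cty_id A sl st :
  sl =1 LVar -> st =1 CTyVar -> subst_cty sl st A = A.
Proof.
elim: A sl st => //=.
- move=> A IHA L B IHB sl st hl ht; rewrite IHA // IHB //.
  by case: L => //= l; rewrite hl.
- by move=> A IHA sl st hl ht; rewrite IHA.
- by move=> A IHA B IHB sl st hl ht; rewrite IHA // IHB.
- by move=> A IHA sl st hl ht; rewrite IHA // => -[|x] //=; rewrite ht.
- move=> A IHA sl st hl ht; rewrite IHA // => [[|x]|x] //=.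
    by rewrite hl.
  by rewrite ht.
- by move=> A IHA sl st hl ht; rewrite IHA.
Qed.

(** The default [f x] is the one built into [theta], so indices beyond the block are fixed too and
    [theta_id] needs no scoping assumption. *)
Lemma nth_map_iota (T : Type) (f : nat -> T) n x :
  nth (f x) (map f (iota 0 n)) x = f x.
Proof.
case: (ltnP x n) => h; first by rewrite (nth_map 0) ?size_iota // nth_iota.
by rewrite nth_default // size_map size_iota.
Qed.

Lemma theta_id nl nt A :
  theta (map LVar (iota 0 nl)) (map CTyVar (iota 0 nt)) A = A.
Proof. by apply: subst_cty_id => x; exact: nth_map_iota. Qed.

(** * Type compilation: renaming, substitution, relocatability *)

Lemma compV_ren A xl xt : compV_ty (ren_ty xl xt A) = ren_cty xl xt (compV_ty A).
Proof.
elim: A xl xt => //=.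
- by move=> A IHA L B IHB xl xt; rewrite IHA IHB.
- by move=> A IHA B IHB xl xt; rewrite IHA IHB.
- by move=> A IHA xl xt; rewrite IHA.
- by move=> A IHA xl xt; rewrite IHA.
Qed.

(** The compiled substitution is a separate function [st'], because after lifting under a binder the
    two sides correspond only pointwise. *)
Lemma compV_subst A sl st st' :
  (forall a, st' a = compV_ty (st a)) ->
  compV_ty (subst_ty sl st A) = subst_cty sl st' (compV_ty A).
Proof.
elim: A sl st st' => //=.
- by move=> A IHA L B IHB sl st st' h; rewrite (IHA _ _ st') // (IHB _ _ st').
- by move=> A IHA B IHB sl st st' h; rewrite (IHA _ _ st') // (IHB _ _ st').
- move=> A IHA sl st st' h; congr (CAllT (CMon _)); apply: IHA => -[|a] //=.
  by rewrite h compV_ren.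
- move=> A IHA sl st st' h; congr (CClo (CAllL (CMon _))); apply: IHA => a /=.
  by rewrite h compV_ren.
Qed.

Lemma compV_inst_ty A B :
  compV_ty (inst_ty A B) = cinst_ty (compV_ty A) (compV_ty B).
Proof. by apply: compV_subst => -[]. Qed.

Lemma compV_inst_loc A L : compV_ty (inst_loc A L) = cinst_loc (compV_ty A) L.
Proof. exact: compV_subst. Qed.

Lemma compV_ok A nl nt : cty_ok nl nt (compV_ty A) = ty_ok nl nt A.
Proof.
elim: A nl nt => //=.
- by move=> A IHA L B IHB nl nt; rewrite IHA IHB.
- by move=> A IHA B IHB nl nt; rewrite IHA IHB.
Qed.

(** Functions and location abstractions become closures, and [CMon] occurs only below [CClo] or
    [CAllT]. Hence every relocatability premise on a compiled type is automatic. *)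
Lemma compV_relocatable A : relocatable (compV_ty A).
Proof. by elim: A => //= A -> B ->. Qed.

(** * Compiled environments and code environments *)

Lemma nloc_comp G : nloc (comp_env G) = nloc G.
Proof. by elim: G => //= e G; rewrite /nloc /= => ->; case: e. Qed.

Lemma nty_comp G : nty (comp_env G) = nty G.
Proof. by elim: G => //= e G; rewrite /nty /= => ->; case: e. Qed.

Lemma nvar_comp G : nvar (comp_env G) = nvar G.
Proof. by elim: G => //= e G; rewrite /nvar /= => ->; case: e. Qed.

Lemma vars_comp G : vars ren_cty (comp_env G) = map compV_ty (vars ren_ty G).
Proof.
elim: G => //= -[A||] G /= -> //; rewrite -!map_comp;
  by apply: eq_map => A /=; rewrite compV_ren.
Qed.

Lemma env_ok_comp G : env_ok cty_ok (comp_env G) = env_ok ty_ok G.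
Proof.
by elim: G => //= -[A||] G /= -> //; rewrite nloc_comp nty_comp compV_ok.
Qed.

Lemma size_vars (T : Type) (ren : (nat -> nat) -> (nat -> nat) -> T -> T)
  (G : seq (entry T)) : size (vars ren G) = nvar G.
Proof. by elim: G => //= -[A||] G /=; rewrite ?size_map /nvar /= => ->. Qed.

Lemma all_vars_ok G :
  env_ok cty_ok G -> all (cty_ok (nloc G) (nty G)) (vars ren_cty G).
Proof.
elim: G => //= -[A||] G IH /=.
- by case/andP=> a /IH h; apply/andP; split; [exact: a | exact: h].
- move/IH; rewrite all_map; apply: sub_all => A /=.
  by apply: cty_ok_ren => x.
- move/IH; rewrite all_map; apply: sub_all => A /=.
  by apply: cty_ok_ren => x.
Qed.

Lemma nloc_code nl nt Bs : nloc (code_env nl nt Bs) = nl.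
Proof.
by rewrite /nloc /code_env !count_cat count_map !count_nseq /= count_pred0 mul1n.
Qed.

Lemma nty_code nl nt Bs : nty (code_env nl nt Bs) = nt.
Proof.
by rewrite /nty /code_env !count_cat count_map !count_nseq /= count_pred0 mul1n addn0.
Qed.

(** Term variables are innermost in [code_env], so no later type or location binder shifts their
    types. *)
Lemma vars_code nl nt Bs : vars ren_cty (code_env nl nt Bs) = Bs.
Proof.
rewrite /code_env; elim: Bs => [|B Bs /= -> //] /=.
elim: nt => [|nt /= -> //] /=.
by elim: nl => [|nl /= ->].
Qed.

Lemma env_ok_code nl nt Bs :
  all (cty_ok nl nt) Bs -> env_ok cty_ok (code_env nl nt Bs).
Proof.
elim: Bs => [_|B Bs IH /= /andP[b bs]] /=.
  rewrite /code_env /=; elim: nt => //=; by elim: nl.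
rewrite -/(code_env nl nt Bs) in IH *.
by rewrite nloc_code nty_code b IH.
Qed.


(** * Stability of target typing under renaming and program growth *)

(* The interleaving of the entries is irrelevant, which allows [xi = id] to
   regroup an environment by sort. *)
Definition ren_env (xi : nat -> nat) (G G' : cenv) : Prop :=
  [/\ nloc G' = nloc G, nty G' = nty G,
      env_ok cty_ok G -> env_ok cty_ok G' &
      forall x A, onth (vars ren_cty G) x = Some A ->
        onth (vars ren_cty G') (xi x) = Some A].

Lemma ren_env_var xi G G' A :
  ren_env xi G G' -> ren_env (upren xi) (EVar A :: G) (EVar A :: G').
Proof.
case=> hl ht h v; split; [exact: hl | exact: ht | | ].
  by rewrite /= hl ht => /andP[-> /h].
by move=> [|x] B //=; apply: v.
Qed.

Lemma ren_env_ty xi G G' : ren_env xi G G' -> ren_env xi (ETy :: G) (ETy :: G').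
Proof.
case=> hl ht h v; split; [exact: hl | exact: (congr1 S ht) | exact: h | ].
by move=> x B /=; rewrite !onth_map; case E: onth => [C|] //=; rewrite (v _ _ E).
Qed.

Lemma ren_env_loc xi G G' :
  ren_env xi G G' -> ren_env xi (ELoc :: G) (ELoc :: G').
Proof.
case=> hl ht h v; split; [exact: (congr1 S hl) | exact: ht | exact: h | ].
by move=> x B /=; rewrite !onth_map; case E: onth => [C|] //=; rewrite (v _ _ E).
Qed.

Lemma ren_env_weaken G A :
  cty_ok (nloc G) (nty G) A -> ren_env S G (EVar A :: G).
Proof.
by rewrite /ren_env /= => a; split=> // ->; rewrite a.
Qed.

(** [vars] presents all types relative to the whole environment, so moving the type and location
    binders outward leaves this list, and with it every term index, unchanged. *)
Lemma ren_env_regroup G :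
  ren_env id G (code_env (nloc G) (nty G) (vars ren_cty G)).
Proof.
split; rewrite ?nloc_code ?nty_code ?vars_code //.
by move=> h; apply/env_ok_code/all_vars_ok.
Qed.

Lemma cscoped_ren xi G G' L M A :
  ren_env xi G G' -> cscoped G L M A -> cscoped G' L (ren_cterm xi M) A.
Proof.
case=> hl ht ok v /and4P[g l m a].
rewrite /cscoped hl ht ok // l a andbT /=.
apply: cterm_ok_ren m => x; rewrite -!(size_vars ren_cty) -!onthTE.
by case E: onth => [B|] // _; rewrite (v _ _ E).
Qed.

(** Inclusion of the two maps would not do: at a site, [phi] also demands absence from the other
    map, and that must survive. *)
Definition phi_incl (P P' : program) : Prop :=
  forall L b, phi P L b -> phi P' L b.

(** Renaming and program growth share one induction. It enters the code bodies, which are themselves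
    typed against the program; a body sees only its own binder block, so it is retyped with the
    identity renaming. *)
Lemma ctyping_ren_incl P P' xi G G' L M A :
  phi_incl P P' -> ren_env xi G G' ->
  ctyping P G L M A -> ctyping P' G' L (ren_cterm xi M) A.
Proof.
move=> inc r h; move: G L M A h xi G' r.
apply: (@ctyping_mind P _ (cntyping P')) => /=.
- move=> G L x A s e xi G' r; apply: C_Var; first exact: (cscoped_ren r s).
  by case: r => _ _ _; apply.
- move=> G L M N A B s _ IH1 _ IH2 xi G' r.
  apply: C_Let (cscoped_ren r s) (IH1 _ _ r) (IH2 _ _ _).
  exact: ren_env_var.
- move=> G L Ws F Bs A s _ IH e _ IHW xi G' r.
  apply: C_Clo (cscoped_ren r s) IH _ _; first by rewrite size_map.
  move=> i i_lt; rewrite (nth_map (VVar 0)) ?e //; exact: IHW.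
- by move=> G L i V A1 A2 s _ IH xi G' r; apply: C_Proj (cscoped_ren r s) (IH _ _ r).
- move=> G L V W A B s _ IH1 _ IH2 xi G' r.
  exact: C_Pair (cscoped_ren r s) (IH1 _ _ r) (IH2 _ _ r).
- move=> G L V A s _ IH xi G' r.
  apply: C_TLam (cscoped_ren r s) _ => L0; case: (r) => -> _ _ _ L0ok.
  exact: IH (ren_env_ty r).
- move=> G L V A B s _ IH rel xi G' r.
  exact: C_TApp (cscoped_ren r s) (IH _ _ r) rel.
- move=> G L L' V A s _ IH xi G' r.
  exact: C_LApp (cscoped_ren r s) (IH _ _ r).
- move=> G L V A s _ IH rel xi G' r.
  exact: C_Unit (cscoped_ren r s) (IH _ _ r) rel.
- move=> G L M N A B s _ IH1 _ IH2 xi G' r.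
  apply: C_Bind (cscoped_ren r s) (IH1 _ _ r) (IH2 _ _ _).
  exact: ren_env_var.
- move=> G L V W A B s _ IH1 _ IH2 xi G' r.
  exact: C_App (cscoped_ren r s) (IH1 _ _ r) (IH2 _ _ r).
- move=> G L L' V W A B s _ IH1 _ IH2 rel xi G' r.
  exact: C_Gen (cscoped_ren r s) (IH1 _ _ r) (IH2 _ _ r) rel.
- move=> G V W A B s _ IH1 _ IH2 rel xi G' r.
  exact: C_Req (cscoped_ren r s) (IH1 _ _ r) (IH2 _ _ r) rel.
- move=> G V W A B s _ IH1 _ IH2 rel xi G' r.
  exact: C_Call (cscoped_ren r s) (IH1 _ _ r) (IH2 _ _ r) rel.
- move=> F nl nt Bs D L' C M Ls As sl st b _ IH relA relB.
  apply: F_Abs sl st (inc _ _ b) _ relA relB.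
  by rewrite -(ren_cterm_id M); apply: IH.
- move=> F nl nt Bs D V Ls As sl st b _ IH relA relB.
  (* [phi_common] is [phi] at any location variable; the index 0 is arbitrary. *)
  apply: F_LAbs sl st (inc (LVar 0) _ b) _ relA relB => L0 L0ok.
  by rewrite -(ren_cterm_id (Val V)); apply: IH.
Qed.

Lemma ctyping_incl P P' G L M A :
  phi_incl P P' -> ctyping P G L M A -> ctyping P' G L M A.
Proof.
by move=> inc h; rewrite -(ren_cterm_id M); apply: ctyping_ren_incl h.
Qed.

Lemma ctyping_scoped P G L M A : ctyping P G L M A -> cscoped G L M A.
Proof. by case. Qed.

(** * Growth of the program by fresh bindings *)

Lemma phi_incl_trans P1 P2 P3 :
  phi_incl P1 P2 -> phi_incl P2 P3 -> phi_incl P1 P3.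
Proof. by move=> h1 h2 L b /h1 /h2. Qed.

Lemma not_used P b :
  b_name b \notin used P -> ~ List.In b P.1 /\ ~ List.In b P.2.
Proof.
have in_names (s : seq binding) : List.In b s -> b_name b \in map b_name s.
  by elim: s => //= c s IH [-> | /IH h]; rewrite inE ?eqxx ?h ?orbT.
rewrite mem_cat negb_or => /andP[n1 n2].
by split=> /in_names h; [move: n1 | move: n2]; rewrite h.
Qed.

Lemma phi_add_at L b P : b_name b \notin used P -> phi (add_at L b P) L b.
Proof. by case/not_used; case: L => [[]|l] /= n1 n2; split; auto. Qed.

(** A binding [c] already in one map differs from [b], whose name is fresh, so adding [b] to the
    other map cannot put [c] there. *)
Lemma phi_incl_add_at L b P :
  b_name b \notin used P -> phi_incl P (add_at L b P).
Proof.
case/not_used=> n1 n2 L' c.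
have ne (s : seq binding) : ~ List.In b s -> List.In c s -> b <> c.
  by move=> n h e; apply: n; rewrite e.
case: L => [[]|l]; case: L' => [[]|l'] /= [h1 h2]; split; auto; case; auto;
  by [apply: ne h1 | move/esym].
Qed.

(** * Derived typing rules *)

Lemma ctyping_var P G L x A :
  env_ok cty_ok G -> loc_ok (nloc G) L -> onth (vars ren_cty G) x = Some A ->
  ctyping P G L (Val (VVar x)) A.
Proof.
move=> g l e; apply: C_Var => //; rewrite /cscoped g l /=.
have x_lt : x < size (vars ren_cty G) by rewrite -onthTE e.
rewrite -{1}(size_vars ren_cty) x_lt /= -(onth_nth CBase _ _ _ e).
by apply/(all_nthP CBase): x_lt; exact: all_vars_ok.
Qed.

(** The scoping premise of [C_Bind] is recovered from the scoping of the subderivations; the rules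
    for [unit] and pairs below are treated alike. *)
Lemma ctyping_bind P G L M N A B :
  ctyping P G L M (CMon A) -> ctyping P (EVar A :: G) L N (CMon B) ->
  ctyping P G L (Val (VDo M N)) (CMon B).
Proof.
move=> dM dN; apply: C_Bind (dM) (dN).
have /and4P[g l m _] := ctyping_scoped dM.
have /and4P[_ _ n b] := ctyping_scoped dN.
by apply/and4P; split=> //; apply/andP; split.
Qed.

Lemma ctyping_unit P G L V A :
  ctyping P G L (Val V) A -> relocatable A ->
  ctyping P G L (Val (VUnit V)) (CMon A).
Proof. by move=> d r; apply: C_Unit (d) r; exact: (ctyping_scoped d). Qed.

Lemma ctyping_pair P G L V W A B :
  ctyping P G L (Val V) A -> ctyping P G L (Val W) B ->
  ctyping P G L (Val (VPair V W)) (CProd A B).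
Proof.
move=> dV dW; apply: C_Pair (dV) (dW).
have /and4P[g l v a] := ctyping_scoped dV.
have /and4P[_ _ w b] := ctyping_scoped dW.
by apply/and4P; split=> //; apply/andP; split.
Qed.

Lemma ctyping_weaken P P' G L M A B :
  phi_incl P P' -> cty_ok (nloc G) (nty G) B ->
  ctyping P G L M A -> ctyping P' (EVar B :: G) L (ren_cterm S M) A.
Proof. by move=> inc b; apply: ctyping_ren_incl => //; exact: ren_env_weaken. Qed.

(** The entry [e] stays in front: it is the binder of the open code itself and not part of the block
    that is regrouped. *)
Lemma ctyping_regroup P G e L M A Bs :
  vars ren_cty G = Bs ->
  ctyping P (e :: G) L M A ->
  ctyping P (e :: code_env (nloc G) (nty G) Bs) L M A.
Proof.
move=> <- d; rewrite -(ren_cterm_id M).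
have r := ren_env_regroup G.
(* In the [EVar] case the renaming has been lifted to [upren id], which still acts as the
   identity. *)
have upid : ren_cterm (upren id) M = ren_cterm id M.
  by rewrite ren_cterm_id ren_id_cval_cterm.2 //; exact: upren_id.
case: e d => [B||] d.
- by rewrite -upid; apply: ctyping_ren_incl (ren_env_var B r) d.
- exact: ctyping_ren_incl (ren_env_ty r) d.
- exact: ctyping_ren_incl (ren_env_loc r) d.
Qed.

Lemma ctyping_call P G L L' A B :
  env_ok cty_ok G -> loc_ok (nloc G) L -> relocatable A ->
  cty_ok (nloc G) (nty G) (CFun A L' (CMon B)) ->
  ctyping P (EVar A :: EVar (CClo (CFun A L' (CMon B))) :: G) L
    (comp_call L L') (CMon B).
Proof.
move=> g l rA /[dup] ab /= /and3P[a l' b].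
set G2 := EVar A :: _.
have g2 : env_ok cty_ok G2 by apply/and3P.
have df : ctyping P G2 L (Val (VVar 1)) (CClo (CFun A L' (CMon B))).
  by apply: ctyping_var.
have dx : ctyping P G2 L (Val (VVar 0)) A by apply: ctyping_var.
have s M : cterm_ok (nloc G) (nty G) (nvar G).+2 M -> cscoped G2 L M (CMon B).
  by move=> m; apply/and4P.
rewrite /comp_call; case: eqP => [e|_].
  by rewrite -e in df; apply: C_App df dx; apply: s.
(* This serves the whole fallthrough branch of [comp_call], including equal sites, which reappear in
   the case split because [L <> L'] was dropped. *)
have gen : ctyping P G2 L (Val (VGen L' (VVar 1) (VVar 0))) (CMon B).
  by apply: C_Gen df dx rA; apply: s; apply/and3P.
clearbody G2; clear l l' ab.
case: L L' df dx s gen => [[]|?] [[]|?] // df dx s _.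
- by apply: C_Req df dx rA; apply: s.
- by apply: C_Call df dx rA; apply: s.
Qed.

(** * Typing of closures *)

Lemma ctyping_closure P G F A L :
  env_ok ty_ok G -> loc_ok (nloc G) L -> cty_ok (nloc G) (nty G) A ->
  cntyping P (CName F (map LVar (iota 0 (nloc G)))
                      (map CTyVar (iota 0 (nty G))))
    (map compV_ty (vars ren_ty G)) A ->
  ctyping P (comp_env G) L (Val (Defs.closure G F)) (CClo A).
Proof.
move=> g l a dF.
have sz : size (map VVar (iota 0 (nvar G))) = size (map compV_ty (vars ren_ty G)).
  by rewrite !size_map size_iota size_vars.
apply: C_Clo dF (sz) _.
  rewrite /cscoped env_ok_comp nloc_comp nty_comp nvar_comp g l /= a andbT.
  rewrite /cname_ok /= !all_map; apply/and3P.
  by split; apply/allP => x; rewrite mem_iota.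
move=> i i_lt; rewrite -sz size_map size_iota in i_lt.
rewrite (nth_map 0) ?size_iota // nth_iota // add0n.
apply: ctyping_var; rewrite ?env_ok_comp ?nloc_comp // vars_comp.
by rewrite onthE (nth_map CBase) // size_map size_vars.
Qed.

Lemma theta_map_id nl nt Bs :
  map (theta (map LVar (iota 0 nl)) (map CTyVar (iota 0 nt))) Bs = Bs.
Proof. by rewrite (eq_map (theta_id nl nt)) map_id. Qed.

Lemma all_relocatable_compV As : all relocatable (map compV_ty As).
Proof. by elim: As => //= A As ->; rewrite compV_relocatable. Qed.

Lemma all_relocatable_tyvars n : all relocatable (map CTyVar (iota 0 n)).
Proof. by rewrite all_map; apply/allP. Qed.

(** The rule [C_Clo] does not tie the location [L0] of the closure to the location [L] of its code,
    so a compiled lambda is typable everywhere. *)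
Lemma ctyping_closure_lam P G F D L C M L0 :
  phi P L (Binding F (comp_codety G (CFun D L C)) (comp_code G (OLam M))) ->
  ctyping P (EVar D :: comp_env G) L M C -> loc_ok (nloc G) L0 ->
  ctyping P (comp_env G) L0 (Val (Defs.closure G F)) (CClo (CFun D L C)).
Proof.
move=> b dM l0.
have /and4P[] := ctyping_scoped dM.
rewrite /= env_ok_comp => /andP[oD g] oL _ oC.
rewrite -[nloc _]/(nloc (comp_env G)) -[nty _]/(nty (comp_env G)) in oL oC.
rewrite nloc_comp nty_comp in oD oL oC.
apply: ctyping_closure => //; first exact/and3P.
(* The block variables instantiate themselves, so [theta] is inserted as an identity to match the
   conclusion of [F_Abs]. *)
rewrite -[X in cntyping _ _ X](theta_map_id (nloc G) (nty G)).
rewrite -[X in cntyping _ _ _ X](theta_id (nloc G) (nty G)).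
apply: (@F_Abs _ _ (nloc G) (nty G)) (all_relocatable_tyvars _)
  (all_relocatable_compV _); rewrite ?size_map ?size_iota ?size_vars //.
  exact: b.
rewrite -nloc_comp -nty_comp; exact: ctyping_regroup (vars_comp G) dM.
Qed.

Lemma ctyping_closure_llam P G F D V L0 :
  env_ok ty_ok G ->
  phi_common P (Binding F (comp_codety G (CAllL D)) (comp_code G (OLLam V))) ->
  (forall L, loc_ok (nloc G).+1 L ->
     ctyping P (ELoc :: comp_env G) L (Val V) D) ->
  loc_ok (nloc G) L0 ->
  ctyping P (comp_env G) L0 (Val (Defs.closure G F)) (CClo (CAllL D)).
Proof.
move=> g b dV l0.
(* Any location in scope serves to read off the scoping of [D]; under the new location binder
   [LVar 0] is one. *)
have /and4P[_ _ _] := ctyping_scoped (dV (LVar 0) isT).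
rewrite -[nloc _]/(nloc (comp_env G)).+1 -[nty _]/(nty (comp_env G)).
rewrite nloc_comp nty_comp => oD.
apply: ctyping_closure => //.
rewrite -[X in cntyping _ _ X](theta_map_id (nloc G) (nty G)).
rewrite -[X in cntyping _ _ _ X](theta_id (nloc G) (nty G)).
apply: (@F_LAbs _ _ (nloc G) (nty G)) (all_relocatable_tyvars _)
  (all_relocatable_compV _); rewrite ?size_map ?size_iota ?size_vars //.
  exact: b.
move=> L lL; rewrite -nloc_comp -nty_comp.
exact: ctyping_regroup (vars_comp G) (dV L lL).
Qed.

(** * Elimination forms applied to a variable bound by [do] *)

Lemma ctyping_tapp_var0 P G L A B :
  env_ok cty_ok (EVar (CAllT (CMon A)) :: G) -> loc_ok (nloc G) L ->
  cty_ok (nloc G) (nty G) B -> cty_ok (nloc G) (nty G) (cinst_ty A B) ->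
  relocatable B ->
  ctyping P (EVar (CAllT (CMon A)) :: G) L (CTApp (VVar 0) B)
    (CMon (cinst_ty A B)).
Proof.
move=> g l b ab rB; apply: (@C_TApp _ _ _ _ (CMon A)) rB.
  exact/and4P.
exact: ctyping_var.
Qed.

Lemma ctyping_lapp_var0 P G L L' A :
  env_ok cty_ok (EVar (CClo (CAllL (CMon A))) :: G) -> loc_ok (nloc G) L ->
  loc_ok (nloc G) L' -> cty_ok (nloc G) (nty G) (cinst_loc A L') ->
  ctyping P (EVar (CClo (CAllL (CMon A))) :: G) L (CLApp (VVar 0) L')
    (CMon (cinst_loc A L')).
Proof.
move=> g l l' a; apply: (@C_LApp _ _ _ _ _ (CMon A)).
  exact/and4P.
exact: ctyping_var.
Qed.

Lemma ctyping_proj_var0 P G L i A1 A2 :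
  env_ok cty_ok (EVar (CProd A1 A2) :: G) -> loc_ok (nloc G) L ->
  relocatable (CProd A1 A2) ->
  ctyping P (EVar (CProd A1 A2) :: G) L
    (Let (CProj i (VVar 0)) (Val (VUnit (VVar 0)))) (CMon (pick_proj i A1 A2)).
Proof.
move=> g l /= /andP[r1 r2]; have /andP[/= /andP[a1 a2] _] := g.
set G1 := EVar (CProd A1 A2) :: G; set A := pick_proj i A1 A2.
have a : cty_ok (nloc G1) (nty G1) A by rewrite /A; case: (i).
have rA : relocatable A by rewrite /A; case: (i).
have g2 : env_ok cty_ok (EVar A :: G1) by apply/andP.
apply: (@C_Let _ _ _ _ _ A); first exact/and4P.
  apply: C_Proj; first exact/and4P.
  exact: ctyping_var.
by apply: ctyping_unit rA; apply: ctyping_var.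
Qed.

(** * Typing of the compiled terms *)

Definition comp_ty (m : mode) (A : ty) : cty :=
  if m is AsTerm then compC_ty A else compV_ty A.

Lemma ctyping_inject m P G L V A :
  ctyping P G L (Val V) (compV_ty A) ->
  ctyping P G L (Val (inject m V)) (comp_ty m A).
Proof. by case: m => //= d; apply: ctyping_unit (compV_relocatable A). Qed.

(** The initial program is arbitrary because it is threaded through the subderivations, and
    [phi_incl] carries earlier results to the final program. The location is free only for values:
    for other terms the output of [comp_call] depends on [L]. *)
Lemma slice_typed (fresh : seq fname -> fname)
    (fresh_notin : forall s : seq fname, fresh s \notin s)
    G L M A (d : typing G L M A) m P :
  (m = AsVal -> is_value M) ->
  let: (V, P') := slice fresh m d P in
  phi_incl P P' /\
  forall L0, loc_ok (nloc G) L0 -> is_value M \/ L0 = L ->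
    ctyping P' (comp_env G) L0 (Val V) (comp_ty m A).
Proof.
have scopedP G' L' M' A' : scoped G' L' M' A' ->
    [/\ env_ok ty_ok G', loc_ok (nloc G') L' & ty_ok (nloc G') (nty G') A'].
  by case/and4P.
elim: d m P => {G L M A} /=.
- move=> G L x A /scopedP[g l a] e m P _; split=> // L0 l0 _.
  apply: ctyping_inject; apply: ctyping_var; rewrite ?env_ok_comp ?nloc_comp //.
  by rewrite vars_comp onth_map e.
- move=> G L L' M A B s d IH m P _.
  have [g l /= /and3P[a l' b]] := scopedP _ _ _ _ s.
  have := IH AsTerm P; case: slice => N P1 [] // inc1 dN.
  set bd := Binding _ _ _.
  have fr : b_name bd \notin used P1 by exact: fresh_notin.
  split; first exact: phi_incl_trans inc1 (phi_incl_add_at _ fr).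
  move=> L0 l0 _; apply: ctyping_inject.
  apply: ctyping_closure_lam l0; first exact: phi_add_at fr.
  by apply: ctyping_incl (phi_incl_add_at _ fr) _; apply: dN; auto.
- move=> G L L' M N A B s d1 IH1 d2 IH2 m P mM.
  (* An application is not a value, which excludes [AsVal] here and forces [L0 = L] below. *)
  have {mM} -> : m = AsTerm by case: m mM => // /(_ erefl).
  have [g l a] := scopedP _ _ _ _ s.
  have := IH1 AsTerm P; case: slice => N1 P1 [] // inc1 dN1.
  have := IH2 AsTerm P1; case: slice => N2 P2 [] // inc2 dN2.
  split; first exact: phi_incl_trans inc1 inc2.
  move=> L0 l0 [//|e]; rewrite {}e {L0} in l0 *.
  (* The first operand was typed in [P1]; slicing the second has grown the program to [P2]. *)
  have {}dN1 := ctyping_incl inc2 (dN1 L l (or_intror erefl)).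
  have {}dN2 := dN2 L l (or_intror erefl).
  have /and4P[gN lN _ aN] := ctyping_scoped dN1.
  apply: ctyping_bind dN1 _; apply: ctyping_bind.
    by apply: (ctyping_weaken (P := P2)) dN2.
  exact: ctyping_call (compV_relocatable A) _.
- move=> G L V A s v d IH m P _.
  have [g l a] := scopedP _ _ _ _ s.
  have := IH AsTerm P; case: slice => N P1 [] // inc1 dN.
  split=> // L0 l0 _; apply: ctyping_inject; apply: C_TLam.
    have /and4P[gN lN tN aN] := ctyping_scoped (dN L0 l0 (or_introl v)).
    by apply/and4P; split=> //; rewrite nloc_comp.
  (* The body is a value, so the induction hypothesis holds at every location, as [C_TLam]
     requires. *)
  by rewrite nloc_comp => L1 l1; apply: dN; auto.
- move=> G L M A B s d IH m P mM.
  have {mM} -> : m = AsTerm by case: m mM => // /(_ erefl).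
  have /and4P[_ _ /= /andP[_ b] ab] := s.
  have := IH AsTerm P; case: slice => N P1 [] // inc1 dN.
  split=> // L0 l0 [//|e]; rewrite {}e {L0} in l0 *.
  have {}dN := dN L l0 (or_intror erefl).
  have /and4P[gN lN _ aN] := ctyping_scoped dN.
  apply: ctyping_bind dN _; rewrite compV_inst_ty.
  apply: ctyping_tapp_var0 => //; rewrite ?compV_relocatable //=.
  + by rewrite gN andbT.
  + by rewrite nloc_comp nty_comp compV_ok.
  + by rewrite -compV_inst_ty nloc_comp nty_comp compV_ok.
- move=> G L V A s v d IH m P _.
  have [g l a] := scopedP _ _ _ _ s.
  have := IH AsTerm P; case: slice => N P1 [] // inc1 dN.
  set bd := Binding _ _ _.
  have fr : b_name bd \notin used P1 by exact: fresh_notin.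
  (* [add_both] is [add_at] at a location variable, whose index is arbitrary. *)
  have inc2 : phi_incl P1 (add_both bd P1).
    exact: (phi_incl_add_at (LVar 0)) fr.
  split; first exact: phi_incl_trans inc1 inc2.
  move=> L0 l0 _; apply: ctyping_inject.
  apply: ctyping_closure_llam l0 => //.
    exact: (phi_add_at (LVar 0)) fr.
  by move=> L1 l1; apply: ctyping_incl inc2 _; apply: dN; auto.
- move=> G L L' M A s d IH m P mM.
  have {mM} -> : m = AsTerm by case: m mM => // /(_ erefl).
  have /and4P[_ _ /= /andP[_ l'] a] := s.
  have := IH AsTerm P; case: slice => N P1 [] // inc1 dN.
  split=> // L0 l0 [//|e]; rewrite {}e {L0} in l0 *.
  have {}dN := dN L l0 (or_intror erefl).
  have /and4P[gN lN _ aN] := ctyping_scoped dN.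
  apply: ctyping_bind dN _; rewrite compV_inst_loc.
  apply: ctyping_lapp_var0 => //=.
  + by rewrite gN andbT.
  + by rewrite nloc_comp.
  + by rewrite -compV_inst_loc nloc_comp nty_comp compV_ok.
- move=> G L M N A B s d1 IH1 d2 IH2 m P mM.
  case: ifP => [/andP[vM vN]|nv].
    (* Both components are values and compile without a [do], so the pair inherits typability at
       every location. *)
    have := IH1 AsVal P; case: slice => V1 P1 [] // inc1 dV1.
    have := IH2 AsVal P1; case: slice => V2 P2 [] // inc2 dV2.
    split; first exact: phi_incl_trans inc1 inc2.
    move=> L0 l0 _; apply: ctyping_inject; apply: ctyping_pair.
      by apply: ctyping_incl inc2 _; apply: dV1; auto.
    by apply: dV2; auto.
  have {mM} -> : m = AsTerm by case: m mM => //; rewrite nv => /(_ erefl).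
  have [g l a] := scopedP _ _ _ _ s.
  have := IH1 AsTerm P; case: slice => N1 P1 [] // inc1 dN1.
  have := IH2 AsTerm P1; case: slice => N2 P2 [] // inc2 dN2.
  split; first exact: phi_incl_trans inc1 inc2.
  move=> L0 l0 [//|e]; rewrite {}e {L0} in l0 *.
  have {}dN1 := ctyping_incl inc2 (dN1 L l (or_intror erefl)).
  have {}dN2 := dN2 L l (or_intror erefl).
  have /and4P[gN lN _ aN] := ctyping_scoped dN1.
  have /and4P[_ _ _ bN] := ctyping_scoped dN2.
  apply: ctyping_bind dN1 _; apply: ctyping_bind.
    by apply: (ctyping_weaken (P := P2)) dN2.
  have g2 : env_ok cty_ok (EVar (compV_ty B) :: EVar (compV_ty A) :: comp_env G).
    by apply/and3P.
  apply: ctyping_unit; last by rewrite /= !compV_relocatable.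
  by apply: ctyping_pair; apply: ctyping_var.
- move=> G L i M A1 A2 s d IH m P mM.
  have {mM} -> : m = AsTerm by case: m mM => // /(_ erefl).
  have := IH AsTerm P; case: slice => N P1 [] // inc1 dN.
  split=> // L0 l0 [//|e]; rewrite {}e {L0} in l0 *.
  have {}dN := dN L l0 (or_intror erefl).
  have /and4P[gN lN _ aN] := ctyping_scoped dN.
  have -> : comp_ty AsTerm (pick_proj i A1 A2) =
      CMon (pick_proj i (compV_ty A1) (compV_ty A2)) by case: (i).
  apply: ctyping_bind dN _; apply: ctyping_proj_var0 => //.
    exact/andP.
  exact: (compV_relocatable (Prod A1 A2)).
Qed.

Theorem theorem4p2 (fresh : seq fname -> fname)
    (fresh_notin : forall s : seq fname, fresh s \notin s)
    (G : env) (L : loc) (M : term) (A : ty) (d : typing G L M A) :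
  ctyping (comp_program fresh d) (comp_env G) L (compC fresh d) (compC_ty A).
Proof.
have l : loc_ok (nloc G) L by case: d => > /and4P[].
have := slice_typed fresh_notin (m := AsTerm) d ([::], [::]).
rewrite /comp_program /compC; case: slice => V P [] // _.
by apply; auto.
Qed.
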